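(* Let $K$ be a field, $R=K[x_1,\ldots,x_n]$ with a term order $<$, $F=(f_1,\ldots,f_m)$ a tuple of non-zero elements of $R$, and $I=\langle F\rangle$. Assume that $F$ is not a Gröbner basis, $F$ consists of homogeneous elements and $<$ is graded. Let $G$ be a homogeneous Gröbner basis of $I$ including $F$. Then there exist a subset $F'$ of $G$ including $F$ (regarded as a tuple $(f_1,\ldots,f_m,f_{m+1},\ldots,f_{m'})$ whose first $m$ entries are those of $F$), an element $g\in G\setminus F'$ and an S-pair $p$ of $F$ such that (1) the guessed signature $\hat S(p)$ is the minimum element of $\mathrm{LSyL}(F)\setminus\mathrm{LSy}(F)$; (2) $\mathrm{LM}(g)=\mathrm{LM}(r)$ and $S_{F'}(g)=S_{F'}(r)=\hat S(p)$, where $r$ is the remainder of any division of the S-polynomial $\mathrm{Spoly}(p)$ with $F'$, and $S_{F'}$ denotes the signature with respect to $F'$; (3) if $G$ is simplified, then there exists $c\in K$ such that $g=cr$.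
   Context: A term order $<$ is graded if $\deg m<\deg n$ implies $m<n$ for monomials $m,n$ (ordinary total degree); homogeneous refers to total degree. $\mathrm{LM}(f)$ and $\mathrm{LC}(f)$ denote the leading monomial and leading coefficient of a non-zero polynomial $f$. A finite set or tuple $H$ of non-zero polynomials generating $I$ is a Gröbner basis of $I$ if $\langle \mathrm{LM}(f)\mid f\in I\setminus\{0\}\rangle=\langle\mathrm{LM}(H)\rangle$, where $\mathrm{LM}(H)$ consists of the leading monomials of the elements of $H$. $H$ is simplified if for every $h\in H$ no non-leading term of $h$ lies in $\langle\mathrm{LM}(H)\rangle$. For a tuple $H=(h_1,\ldots,h_a)$ of non-zero polynomials generating $I$, define the following. A division of $f\in R$ with $H$ is an expression $f=\sum_{i=1}^a q_ih_i+r$ with $q_i,r\in R$, $\mathrm{LM}(q_ih_i)\le\mathrm{LM}(f)$ whenever $q_i\ne0$, and $r=0$ or no term of $r$ lies in $\langle\mathrm{LM}(H)\rangle$; $r$ is the remainder. $R^a=\bigoplus_{i=1}^a Re_i$ carries the Schreyer order $\prec$ of $H$: $x^\alpha e_i\prec x^\beta e_j$ iff $x^\alpha\mathrm{LM}(h_i)<x^\beta\mathrm{LM}(h_j)$, or $x^\alpha\mathrm{LM}(h_i)=x^\beta\mathrm{LM}(h_j)$ and $i<j$. For non-zero $u\in R^a$, $\mathrm{LM}(u)$ is the $\prec$-largest monomial $x^\alpha e_i$ occurring in $u$; for a submodule $M$, $\mathrm{LM}(M)$ is the set of leading monomials of its non-zero elements. $\bar u$ is the image of $u$ under the $R$-linear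 map $e_i\mapsto h_i$; $\mathrm{Syz}(H)$ is the kernel of this map, and $\mathrm{Syz}(\mathrm{LM}(H))\subset R^a$ is the kernel of $e_i\mapsto\mathrm{LM}(h_i)$. Put $\mathrm{LSy}(H)=\mathrm{LM}(\mathrm{Syz}(H))$ and $\mathrm{LSyL}(H)=\mathrm{LM}(\mathrm{Syz}(\mathrm{LM}(H)))$. The signature of a non-zero $f\in I$ with respect to $H$ is $S_H(f)=\min_\prec\{\mathrm{LM}(u)\mid u\in R^a,\ \bar u=f\}$. An S-pair of $H$ is a pair of monomials $p=(x^\gamma e_k,x^\delta e_\ell)$ in $R^a$ with $k<\ell$ and $x^\gamma\mathrm{LM}(h_k)=x^\delta\mathrm{LM}(h_\ell)$. Its S-polynomial is $\mathrm{Spoly}(p)=\frac{1}{\mathrm{LC}(h_k)}x^\gamma h_k-\frac{1}{\mathrm{LC}(h_\ell)}x^\delta h_\ell$, and its guessed signature is $\hat S(p)=x^\delta e_\ell$. Minima are taken with respect to $\prec$. When $F'=(f_1,\ldots,f_m,\ldots,f_{m'})$ extends $F$, $R^m$ is identified with the submodule $Re_1\oplus\cdots\oplus Re_m$ of $R^{m'}$ (the Schreyer order of $F'$ restricts to that of $F$). *)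

(* Defs.v *)
From HB Require Import structures.
From mathcomp Require Import all_boot all_order all_algebra.
From mathcomp.multinomials Require Import mpoly.

Set Implicit Arguments.
Unset Strict Implicit.
Unset Printing Implicit Defensive.

Import GRing.Theory.
Local Open Scope ring_scope.

Definition idealGen (R : comNzRingType) (S : R -> Prop) (f : R) : Prop :=
  exists2 s : seq (R * R),
    forall p, p \in s -> S p.2 & f = \sum_(p <- s) p.1 * p.2.

Definition isMinimum (T : Type) (lt : T -> T -> Prop) (S : T -> Prop) (x : T) :=
  S x /\ forall y, S y -> x = y \/ lt x y.

Section TermOrder.
Context {n : nat}.
Implicit Types (ord : rel 'X_{1..n}).

(* Strict presentation; that the order is a well-order follows from these
   conditions (Dickson's lemma). *)
Record isTermOrder ord : Prop := IsTermOrder {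
  term_order_irr : irreflexive ord;
  term_order_trans : transitive ord;
  term_order_total : forall a b, [|| ord a b, a == b | ord b a];
  term_order_add : forall c a b, ord a b -> ord (a + c)%MM (b + c)%MM;
  term_order_gt0 : forall a, a != 0%MM -> ord 0%MM a
}.

Definition gradedOrder ord : Prop :=
  forall a b : 'X_{1..n}, (mdeg a < mdeg b)%N -> ord a b.

Definition omax ord (a b : 'X_{1..n}) := if ord a b then b else a.

End TermOrder.

Section Polynomials.
Context {K : fieldType} {n : nat} (ord : rel 'X_{1..n}).
Local Notation P := {mpoly K[n]}.

(* The library's [mlead] is tied to one fixed order.  As there, the value at 0
   is the default 0%MM, which is neutral for the maximum. *)
Definition LM (f : P) : 'X_{1..n} := \big[omax ord/0%MM]_(t <- msupp f) t.

Definition LC (f : P) : K := f@_(LM f).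

Definition homogeneous (f : P) : Prop := exists d : nat, f \is d.-homog.

Definition LMideal (H : seq P) : P -> Prop :=
  idealGen (fun t : P => exists2 h, h \in H & t = 'X_[LM h]).

Definition groebnerBasis (I : P -> Prop) (H : seq P) : Prop :=
  [/\ 0 \notin H,
      forall f, I f <-> idealGen (fun h => h \in H) f &
      forall f,
        idealGen (fun t : P => exists g, [/\ I g, g != 0 & t = 'X_[LM g]]) f
        <-> LMideal H f].

Definition simplified (H : seq P) : Prop :=
  forall h t, h \in H -> t \in msupp h -> t != LM h -> ~ LMideal H 'X_[t].

End Polynomials.

(* The monomial x^s.1 e_(s.2) of R^a. *)
Definition modMon (n a : nat) : Type := ('X_{1..n} * 'I_a)%type.

(* The identification of R^a with R e_1 + ... + R e_a inside R^(a + k). *)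
Definition widenMon (n a k : nat) (s : modMon n a) : modMon n (a + k) :=
  (s.1, lshift k s.2).

Section Module.
Context {K : fieldType} {n : nat} (ord : rel 'X_{1..n}).
Context {a : nat} (H : a.-tuple {mpoly K[n]}).
Local Notation P := {mpoly K[n]}.
Local Notation LM := (LM ord).

Definition monImage (s : modMon n a) : 'X_{1..n} :=
  (s.1 + LM (tnth H s.2))%MM.

Definition schreyer (s t : modMon n a) : Prop :=
  ord (monImage s) (monImage t) \/
  monImage s = monImage t /\ (s.2 < t.2)%N.

Definition inSupp (u : 'rV[P]_a) (s : modMon n a) : Prop :=
  s.1 \in msupp (u 0 s.2).

(* Relational: no monomial is a leading monomial of 0. *)
Definition isModLM (u : 'rV[P]_a) (s : modMon n a) : Prop :=
  isMinimum (fun t t' => schreyer t' t) (inSupp u) s.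

Definition LMset (M : 'rV[P]_a -> Prop) (s : modMon n a) : Prop :=
  exists2 u, M u & isModLM u s.

Definition evalAt (T : a.-tuple P) (u : 'rV[P]_a) : P :=
  \sum_(i < a) u 0 i * tnth T i.

Definition Syz (T : a.-tuple P) (u : 'rV[P]_a) : Prop := evalAt T u = 0.

Definition LMtuple : a.-tuple P := [tuple 'X_[LM (tnth H i)] | i < a].

Definition LSy : modMon n a -> Prop := LMset (Syz H).

(* Leading monomials are still taken for the Schreyer order of H. *)
Definition LSyL : modMon n a -> Prop := LMset (Syz LMtuple).

(* s = S_H(f) *)
Definition isSignature (f : P) (s : modMon n a) : Prop :=
  isMinimum schreyer (LMset (fun u => evalAt H u = f)) s.

(* f = \sum_i q_i h_i + r; for f = 0 only q = 0 is allowed, LM(0) being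
   undefined. *)
Definition isDivision (f : P) (q : 'rV[P]_a) (r : P) : Prop :=
  [/\ f = evalAt H q + r,
      forall i, q 0 i != 0 ->
        f != 0 /\ (LM (q 0 i * tnth H i) = LM f \/
                   ord (LM (q 0 i * tnth H i)) (LM f)) &
      forall t, t \in msupp r -> ~ LMideal ord H 'X_[t]].

Definition isSpair (p : modMon n a * modMon n a) : Prop :=
  (p.1.2 < p.2.2)%N /\ monImage p.1 = monImage p.2.

Definition Spoly (p : modMon n a * modMon n a) : P :=
  (LC ord (tnth H p.1.2))^-1 *: ('X_[p.1.1] * tnth H p.1.2) -
  (LC ord (tnth H p.2.2))^-1 *: ('X_[p.2.1] * tnth H p.2.2).

Definition guessedSig (p : modMon n a * modMon n a) : modMon n a := p.2.

End Module.

(* Main.v *)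
Require Import Defs.
From Stdlib Require Import Classical.
From mathcomp Require Import all_boot all_order all_algebra.
From mathcomp.multinomials Require Import mpoly.

Set Implicit Arguments.
Unset Strict Implicit.
Unset Printing Implicit Defensive.

Import GRing.Theory.
Local Open Scope ring_scope.

(* Let s = x^delta e_l be the minimum of LSyL(F) \ LSy(F), let D be the degree of
   its image x^delta LM(f_l), put a = x^delta f_l, and let W be the span of the
   x^alpha f_i with x^alpha e_i below s.  Since every element of LSyL(F) below s
   lies in LSy(F), leading monomials of W lie in <LM(F)>, and s not in LSy(F)
   means a is not in W.  By homogeneity every element of I of degree < D is in W.

   Keep a finite T in G of elements with leading monomials of degree D, smaller
   than x^delta LM(f_l) and irreducible modulo F and the earlier elements, such
   that a is not in W + <T>_K.  An element r of (K\{0}) a + W + <T>_K with minimal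
   leading monomial is irreducible modulo F and T, so LM(r) = LM(g) for some g in
   G: a proper divisor of LM(r) has degree < D, hence cannot be the leading
   monomial of an irreducible element of I.  If a is in W + <T>_K + K g, stop;
   otherwise add g to T.  When the process stops, F' consists of F and T: modulo
   W + <T>_K, which is the set of elements of F'-signature below s, both g and any
   remainder of Spoly(p) are nonzero multiples of a.  Hence they have signature s,
   and some combination g - c r lies in W + <T>_K, where leading monomials are
   reducible; this gives (2), and (3) when no term of g is reducible. *)

(** * Minimal elements and ideals given by generators *)

Lemma exists_minimal (T : Type) (rk : T -> nat) (P : T -> Prop) :
  (exists x, P x) -> exists2 x, P x & forall y, P y -> (rk x <= rk y)%N.
Proof.
case=> x; have [N] := ubnP (rk x); elim: N x => // N IHN x /ltnSE leN Px.
have [[y Py lt_yx]|no_lt] := classic (exists2 y, P y & (rk y < rk x)%N).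
  exact: IHN y (leq_trans lt_yx leN) Py.
by exists x => // y Py; rewrite leqNgt; apply/negP => lt_yx; apply: no_lt; exists y.
Qed.

Section Ideals.
Context {R : comNzRingType}.
Implicit Types (S : R -> Prop) (f g : R).

Lemma idealGen_gen S f : S f -> idealGen S f.
Proof.
move=> Sf; exists [:: (1, f)]; last by rewrite big_seq1 mul1r.
by move=> p; rewrite inE => /eqP->.
Qed.

Lemma idealGenD S f g : idealGen S f -> idealGen S g -> idealGen S (f + g).
Proof.
move=> [s sS ->] [t tS ->]; exists (s ++ t); last by rewrite big_cat.
by move=> p; rewrite mem_cat => /orP[/sS|/tS].
Qed.

Lemma idealGenM S c f : idealGen S f -> idealGen S (c * f).
Proof.
move=> [s sS ->]; exists [seq (c * p.1, p.2) | p <- s].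
  by move=> _ /mapP[p /sS Sp ->].
by rewrite big_map mulr_sumr; apply: eq_bigr => p _; rewrite mulrA.
Qed.

Lemma idealGen0 S : idealGen S 0.
Proof. by exists [::] => //; rewrite big_nil. Qed.

Lemma idealGen_sub S S' : (forall f, S f -> idealGen S' f) ->
  forall f, idealGen S f -> idealGen S' f.
Proof.
move=> SS' _ [s sS ->]; elim: s sS => [|p s IHs] sS.
  by rewrite big_nil; apply: idealGen0.
rewrite big_cons; apply: idealGenD.
  by apply/idealGenM/SS'/sS; rewrite mem_head.
by apply: IHs => q qs; apply: sS; rewrite inE qs orbT.
Qed.

End Ideals.

(** * Graded term orders as ranks in the natural numbers *)

Section Rank.
Context {n : nat} (ord : rel 'X_{1..n}).
Context (ord_term : isTermOrder ord) (ord_graded : gradedOrder ord).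

(* For a graded order only finitely many monomials lie below a given one, so
   counting them embeds the order into [nat]. *)
Definition mrank (a : 'X_{1..n}) : nat :=
  size [seq b : 'X_{1..n} <- [seq bmnm c | c <- enum {: 'X_{1..n < (mdeg a).+1}}]
       | ord b a].

Lemma ord_mdeg a b : ord a b -> (mdeg a <= mdeg b)%N.
Proof.
move=> lt_ab; rewrite leqNgt; apply/negP => /ord_graded lt_ba.
by have := term_order_trans ord_term lt_ab lt_ba; rewrite (term_order_irr ord_term).
Qed.

Lemma mem_below a b :
  (b \in [seq b : 'X_{1..n} <- [seq bmnm c | c <- enum {: 'X_{1..n < (mdeg a).+1}}]
         | ord b a]) = ord b a.
Proof.
rewrite mem_filter andb_idr // => lt_ba.
have lt_b : (mdeg b < (mdeg a).+1)%N by rewrite ltnS ord_mdeg.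
by apply/mapP; exists (BMultinom lt_b) => //; rewrite mem_enum.
Qed.

Lemma mrank_homo a b : ord a b -> (mrank a < mrank b)%N.
Proof.
(* Strictness comes from putting [a] itself in front of the monomials below it: this duplicate-free
   list still lies below [b]. *)
move=> lt_ab; rewrite -[(_ < _)%N]/(size (a :: _) <= _)%N.
apply: uniq_leq_size => [|c].
  rewrite /= mem_below (term_order_irr ord_term) /=.
  by apply/filter_uniq; rewrite map_inj_uniq ?enum_uniq //; apply: val_inj.
rewrite inE !mem_below => /orP[/eqP->//|lt_ca].
exact: (term_order_trans ord_term) lt_ca lt_ab.
Qed.

Lemma mrank_inj : injective mrank.
Proof.
move=> a b eq_ab; have := term_order_total ord_term a b.
by case/or3P => [/mrank_homo||/mrank_homo]; rewrite ?eq_ab ?ltnn // => /eqP.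
Qed.

Lemma ord_mrank a b : ord a b = (mrank a < mrank b)%N.
Proof.
apply/idP/idP => [/mrank_homo//|lt_ab].
case/or3P: (term_order_total ord_term a b) => // [/eqP eq_ab|/mrank_homo].
  by rewrite eq_ab ltnn in lt_ab.
by rewrite ltnNge (ltnW lt_ab).
Qed.

Lemma ltn_mrankD c a b : (mrank (a + c) < mrank (b + c))%N = (mrank a < mrank b)%N.
Proof.
apply/idP/idP => [|lt_ab]; last by rewrite -ord_mrank term_order_add // ord_mrank.
case: (ltngtP (mrank a) (mrank b)) => // [|/mrank_inj->]; last by rewrite ltnn.
by rewrite -ord_mrank => /(term_order_add ord_term c); rewrite ord_mrank; case: ltngtP.
Qed.

Lemma leq_mrankD c a b : (mrank (a + c) <= mrank (b + c))%N = (mrank a <= mrank b)%N.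
Proof. by rewrite leqNgt ltn_mrankD -leqNgt. Qed.

Lemma leq_mrank_mdeg a b : (mrank a <= mrank b)%N -> (mdeg a <= mdeg b)%N.
Proof. by rewrite leqNgt -ord_mrank => /negP le; rewrite leqNgt; apply/negP => /ord_graded. Qed.

(** * Leading monomials and top coefficients of products *)

Section Leading.
Context {K : fieldType}.
Implicit Types (f g h p q : {mpoly K[n]}) (m M a b t : 'X_{1..n}).
Local Notation LM := (LM ord).
Local Notation LC := (LC ord).

Lemma LM_max f : f != 0 ->
  LM f \in msupp f /\ forall t, t \in msupp f -> (mrank t <= mrank (LM f))%N.
Proof.
rewrite -msupp_eq0 /LM; elim: (msupp f) => // x s IHs _; rewrite big_cons.
have [->|s_neq0] := eqVneq s [::].
  (* The fold ends in the default [0%MM], which must not win against [x]; it is the least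
     monomial. *)
  rewrite big_nil /omax ifN; last first.
    apply/negP=> lt_x0; have x_neq0 : x != 0%MM.
      by apply: contraTneq lt_x0 => ->; rewrite (term_order_irr ord_term).
    have := term_order_trans ord_term lt_x0 (term_order_gt0 ord_term x_neq0).
    by rewrite (term_order_irr ord_term).
  by rewrite mem_head; split=> // t; rewrite inE => /eqP->.
have [in_s ub_s] := IHs s_neq0; rewrite /omax ord_mrank; case: ltnP => [lt_x|le_x].
  rewrite inE in_s orbT; split=> // t; rewrite inE => /orP[/eqP->|/ub_s//].
  exact: ltnW.
rewrite mem_head; split=> // t; rewrite inE => /orP[/eqP->//|/ub_s le_t].
exact: leq_trans le_t le_x.
Qed.

Lemma LM_msupp f : f != 0 -> LM f \in msupp f.
Proof. by case/LM_max. Qed.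

Lemma msupp_neq0 f t : t \in msupp f -> f != 0.
Proof. by apply: contraTneq => ->; rewrite msupp0. Qed.

Lemma msupp_le_LM f t : t \in msupp f -> (mrank t <= mrank (LM f))%N.
Proof. by move=> tf; apply: (LM_max (msupp_neq0 tf)).2. Qed.

Lemma LC_neq0 f : f != 0 -> LC f != 0.
Proof. by move/LM_msupp; rewrite mcoeff_msupp. Qed.

Lemma LM_unique f t : t \in msupp f ->
  (forall m, m \in msupp f -> (mrank m <= mrank t)%N) -> LM f = t.
Proof.
move=> tf ub; have f0 := msupp_neq0 tf.
by apply/mrank_inj/eqP; rewrite eqn_leq ub ?LM_msupp // msupp_le_LM.
Qed.

Lemma msupp_coef0 f t : (mrank (LM f) < mrank t)%N -> f@_t = 0.
Proof.
move=> lt_ft; apply/eqP; rewrite mcoeff_eq0.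
by apply: contraTN lt_ft => /msupp_le_LM; rewrite leqNgt.
Qed.

Lemma LMX t : LM ('X_[t] : {mpoly K[n]}) = t.
Proof. by apply: LM_unique; rewrite ?msuppX ?mem_head // => m; rewrite inE => /eqP->. Qed.

Lemma LMZ c f : c != 0 -> LM (c *: f) = LM f.
Proof.
move=> c0; have [->|f0] := eqVneq f 0; first by rewrite scaler0.
apply: LM_unique => [|m]; rewrite mcoeff_msupp mcoeffZ mulf_eq0 (negbTE c0) /=.
  exact: LC_neq0.
by rewrite -mcoeff_msupp; apply: msupp_le_LM.
Qed.

Lemma LM_addl f g : g != 0 -> f = 0 \/ (mrank (LM f) < mrank (LM g))%N ->
  f + g != 0 /\ LM (f + g) = LM g.
Proof.
move=> g0 [->|lt_fg]; first by rewrite add0r.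
have fg : LM g \in msupp (f + g).
  by rewrite mcoeff_msupp mcoeffD msupp_coef0 // add0r LC_neq0.
split; first exact: msupp_neq0 fg.
apply: LM_unique => // m; rewrite mcoeff_msupp mcoeffD => mfg.
rewrite leqNgt; apply: contraNN mfg => lt_m.
by rewrite !msupp_coef0 ?addr0 //; apply: ltn_trans lt_m.
Qed.

Lemma msuppM_le_mrank p h M :
    (forall a, a \in msupp p -> (mrank (a + LM h) <= mrank M)%N) ->
  forall m, m \in msupp (p * h) -> (mrank m <= mrank M)%N.
Proof.
move=> ub m /msuppM_le /allpairsP[[a b] /= [ap bh ->]].
apply: leq_trans (ub a ap); rewrite addmC [(a + _)%MM]addmC leq_mrankD.
exact: msupp_le_LM.
Qed.

(** Only the leading term of [h] can reach the bound [M]: after its removal, in [h'], every product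
    of monomials falls strictly below [M]. *)
Lemma mcoeffM_top p h M :
    (forall a, a \in msupp p -> (mrank (a + LM h) <= mrank M)%N) ->
  (p * h)@_M = if (LM h <= M)%MM then p@_(M - LM h) * LC h else 0.
Proof.
move=> ub; set h' := h - LC h *: 'X_[LM h].
have -> : p * h = LC h *: (p * 'X_[LM h]) + p * h'.
  by rewrite scalerAr -mulrDr addrC subrK.
rewrite mcoeffD mcoeffZ [(p * h')@_M](_ : _ = 0) ?addr0.
  case: ifP => [le_M|nle_M].
    by rewrite -{1}(submK le_M) addmC mcoeffMX mulrC.
  rewrite [X in _ * X](_ : _ = 0) ?mulr0 //; apply/eqP; rewrite mcoeff_eq0.
  rewrite (perm_mem (msuppMX _ _)); apply/mapP => -[a _ defM].
  by rewrite defM lem_addr in nle_M.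
apply/eqP; rewrite mcoeff_eq0; apply/negP => /msuppM_le /allpairsP[[a b] /= [ap bh' defM]].
have b_neq : b != LM h.
  apply: contraTneq bh' => ->; rewrite mcoeff_msupp mcoeffB mcoeffZ mcoeffX eqxx.
  by rewrite mulr1 subrr eqxx.
have bh : b \in msupp h.
  move: bh'; rewrite !mcoeff_msupp mcoeffB mcoeffZ mcoeffX [LM h == b]eq_sym (negbTE b_neq).
  by rewrite mulr0 subr0.
have := ub a ap; rewrite defM addmC [(a + b)%MM]addmC leq_mrankD leqNgt ltn_neqAle.
by rewrite msupp_le_LM // andbT negbK => /eqP/mrank_inj eq_b; rewrite eq_b eqxx in b_neq.
Qed.

Lemma LMM p h : p != 0 -> h != 0 -> LM (p * h) = (LM p + LM h)%MM.
Proof.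
move=> p0 h0; have ub a : a \in msupp p -> (mrank (a + LM h) <= mrank (LM p + LM h))%N.
  by move=> ap; rewrite leq_mrankD msupp_le_LM.
apply: LM_unique => [|m]; last exact: msuppM_le_mrank.
by rewrite mcoeff_msupp mcoeffM_top // lem_addl addmK mulf_neq0 ?LC_neq0.
Qed.

Lemma LM_cancel f g : g != 0 -> LM g = LM f -> f - (LC f / LC g) *: g != 0 ->
  (mrank (LM (f - (LC f / LC g) *: g)) < mrank (LM f))%N.
Proof.
move=> g0 eq_fg; set r := f - _ => r0; have := LM_msupp r0; set t := LM r => tr.
rewrite ltn_neqAle; apply/andP; split; last first.
  move: (tr); rewrite mcoeff_msupp leqNgt; apply: contraNN => lt_t.
  by rewrite mcoeffB mcoeffZ !msupp_coef0 ?eq_fg ?mulr0 ?subrr.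
apply: contraTneq tr => /mrank_inj->; rewrite mcoeff_msupp mcoeffB mcoeffZ.
by rewrite -{2}eq_fg divfK ?LC_neq0 // subrr eqxx.
Qed.

(** In a combination of monomials equal to ['X_[t]], the coefficient at [t] is nonzero, so some
    summand contains [t], and its generator divides [t]. *)
Lemma LMideal_monomial (H : seq {mpoly K[n]}) t :
  LMideal ord H 'X_[t] <-> exists2 h, h \in H & (LM h <= t)%MM.
Proof.
split=> [[s sH Xt]|[h hH le_t]]; last first.
  by rewrite -(submK le_t) mpolyXD; apply/idealGenM/idealGen_gen; exists h.
have : ('X_[t] : {mpoly K[n]})@_t != 0 by rewrite mcoeffX eqxx oner_neq0.
have [/hasP[p /sH[h hH ->]]|/hasPn no] := boolP (has (fun p : _ * _ => t \in msupp (p.1 * p.2)) s).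
  by rewrite (perm_mem (msuppMX _ _)) => /mapP[a _ ->]; exists h; rewrite ?lem_addr.
rewrite Xt raddf_sum big_seq big1 ?eqxx // => p /no.
by rewrite mcoeff_msupp negbK => /eqP.
Qed.

End Leading.
End Rank.

(** * Schreyer order, signatures and syzygies *)

Section Signatures.
Context {K : fieldType} {n : nat} (ord : rel 'X_{1..n}).
Context (ord_term : isTermOrder ord) (ord_graded : gradedOrder ord).
Context {a : nat} (H : a.-tuple {mpoly K[n]}).
Implicit Types (u v w : 'rV[{mpoly K[n]}]_a) (s t : modMon n a) (f g : {mpoly K[n]}).
Implicit Types (T : a.-tuple {mpoly K[n]}).
Local Notation LM := (LM ord).
Local Notation LC := (LC ord).
Local Notation mrank := (mrank ord).
Local Notation monImage := (monImage ord H).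
Local Notation schreyer := (schreyer ord H).

(** The index is less than [a], so it serves as the last digit in base [a]: one number encodes the
    lexicographic comparison made by [schreyer]. *)
Definition srank s : nat := (mrank (monImage s) * a + s.2)%N.

Lemma schreyer_srank s t : schreyer s t <-> (srank s < srank t)%N.
Proof.
rewrite /srank; split=> [[|[-> lt_st]]|lt_st]; last 2 first.
- by rewrite ltn_add2l.
- have [lt|gt|eq_m] := ltngtP (mrank (monImage s)) (mrank (monImage t)).
  + by left; rewrite (ord_mrank ord_term ord_graded).
  + move: lt_st; rewrite ltnNge => /negP[]; apply: leq_trans (leq_addr _ _).
    apply: leq_trans (_ : _ <= (mrank (monImage t)).+1 * a)%N _.
      by rewrite mulSn addnC leq_add2r ltnW.
    by rewrite leq_mul2r gt orbT.
  + right; split; first exact: (mrank_inj ord_term ord_graded).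
    by move: lt_st; rewrite eq_m ltn_add2l.
rewrite (ord_mrank ord_term ord_graded) => lt_m.
apply: leq_trans (leq_addr _ _).
apply: leq_trans (_ : _ <= (mrank (monImage s)).+1 * a)%N _.
  by rewrite mulSn addnC ltn_add2r.
by rewrite leq_mul2r lt_m orbT.
Qed.

Lemma srank_inj : injective srank.
Proof.
move=> s t eq_st; have nlt : ~ schreyer s t by rewrite schreyer_srank eq_st ltnn.
have ngt : ~ schreyer t s by rewrite schreyer_srank eq_st ltnn.
have eq_m : monImage s = monImage t.
  have := term_order_total ord_term (monImage s) (monImage t).
  by case/or3P => [lt|/eqP//|gt]; [case: nlt; left | case: ngt; left].
have eq_i : s.2 = t.2.
  apply: val_inj => /=; case: (ltngtP s.2 t.2) => // lt_i.
  - by case: nlt; right.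
  - by case: ngt; right.
case: s t eq_m eq_i {eq_st nlt ngt} => [x i] [y j] /= eq_m eq_i; rewrite -eq_i in eq_m *.
by congr (_, _); apply: (can_inj (addmK (LM (tnth H i)))).
Qed.

Lemma schreyer_mrank_le s t :
  schreyer s t -> (mrank (monImage s) <= mrank (monImage t))%N.
Proof. by case=> [|[->//]]; rewrite (ord_mrank ord_term ord_graded) => /ltnW. Qed.

Definition mon s : 'rV[{mpoly K[n]}]_a := 'X_[s.1] *: delta_mx 0 s.2.

Lemma evalAtD T u v : evalAt T (u + v) = evalAt T u + evalAt T v.
Proof. by rewrite /evalAt -big_split; apply: eq_bigr => i _; rewrite mxE mulrDl. Qed.

Lemma evalAtZ T c u : evalAt T (c *: u) = c * evalAt T u.
Proof. by rewrite /evalAt mulr_sumr; apply: eq_bigr => i _; rewrite mxE mulrA. Qed.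

Lemma evalAt_delta T i : evalAt T (delta_mx 0 i) = tnth T i.
Proof.
rewrite /evalAt (bigD1 i) //= big1 => [|j ne_ji]; rewrite mxE eqxx /=.
  by rewrite eqxx mul1r addr0.
by rewrite (negbTE ne_ji) mul0r.
Qed.

Lemma evalAt_mon T s : evalAt T (mon s) = 'X_[s.1] * tnth T s.2.
Proof. by rewrite evalAtZ evalAt_delta. Qed.

Lemma evalAt_Zmon T (c : K) s :
  evalAt T (c%:MP *: mon s) = c *: ('X_[s.1] * tnth T s.2).
Proof. by rewrite evalAtZ evalAt_mon mul_mpolyC. Qed.

Lemma inSupp_mon s t : inSupp (mon s) t <-> t = s.
Proof.
rewrite /inSupp !mxE eqxx /=; case: eqVneq => [eq_ts|ne_ts] /=; last first.
  by rewrite mulr0 msupp0; split=> // eq_ts; rewrite eq_ts eqxx in ne_ts.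
rewrite mulr1 msuppX inE; split=> [/eqP eq1|->//].
by case: s t eq_ts eq1 => [? ?] [? ?] /= -> ->.
Qed.

Lemma inSuppD u v t : inSupp (u + v) t -> inSupp u t \/ inSupp v t.
Proof. by rewrite /inSupp mxE => /msuppD_le; rewrite mem_cat => /orP. Qed.

Lemma inSuppZ (c : K) u t : inSupp (c%:MP *: u) t -> inSupp u t.
Proof. by rewrite /inSupp mxE mul_mpolyC => /msuppZ_le. Qed.

Lemma inSupp0 t : ~ inSupp (0 : 'rV[{mpoly K[n]}]_a) t.
Proof. by rewrite /inSupp mxE msupp0. Qed.

(** This is the space W of the overview. It is closed under sums and scalars but is not an ideal,
    since multiplication raises signatures. *)
Definition sigBelow s f : Prop :=
  exists2 u, forall t, inSupp u t -> schreyer t s & f = evalAt H u.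

Lemma sigBelow0 s : sigBelow s 0.
Proof.
exists 0 => [t /inSupp0//|].
by rewrite /evalAt big1 // => i _; rewrite mxE mul0r.
Qed.

Lemma sigBelowD s f g : sigBelow s f -> sigBelow s g -> sigBelow s (f + g).
Proof.
move=> [u us ->] [v vs ->]; exists (u + v); last by rewrite evalAtD.
by move=> t /inSuppD[/us|/vs].
Qed.

Lemma sigBelowZ s (c : K) f : sigBelow s f -> sigBelow s (c *: f).
Proof.
move=> [u us ->]; exists (c%:MP *: u); last by rewrite evalAtZ mul_mpolyC.
by move=> t /inSuppZ/us.
Qed.

Lemma sigBelowN s f : sigBelow s f -> sigBelow s (- f).
Proof. by move=> sf; rewrite -scaleN1r; apply: sigBelowZ. Qed.

Lemma sigBelowB s f g : sigBelow s f -> sigBelow s g -> sigBelow s (f - g).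
Proof. by move=> sf sg; apply: sigBelowD sf (sigBelowN sg). Qed.

Lemma sigBelow_mon s t : schreyer t s -> sigBelow s ('X_[t.1] * tnth H t.2).
Proof. by move=> lt_ts; exists (mon t); rewrite ?evalAt_mon // => y /inSupp_mon->. Qed.

(** A representation of [f] with leading monomial [s] is explicit. One with a smaller leading
    monomial would put [f], and hence the product attached to [s], into the space below [s]. *)
Lemma isSignature_coset s c f : c != 0 ->
    sigBelow s (f - c *: ('X_[s.1] * tnth H s.2)) ->
    ~ sigBelow s ('X_[s.1] * tnth H s.2) ->
  isSignature ord H f s.
Proof.
set b := 'X_[s.1] * _ => c0 [v vs def_f] b_not; split.
  exists (v + c%:MP *: mon s).
    by rewrite evalAtD evalAt_Zmon -def_f subrK.
  split=> [|t /inSuppD[/vs|/inSuppZ/inSupp_mon]]; [|by right|by left].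
  (* The support of [v] is strictly below [s], so nothing cancels the term at [s]. *)
  have vs0 : (v 0 s.2)@_s.1 = 0.
    apply/eqP; rewrite mcoeff_eq0; apply/negP => /vs/schreyer_srank.
    by rewrite ltnn.
  rewrite /inSupp mcoeff_msupp mxE mcoeffD vs0 add0r mxE mul_mpolyC mcoeffZ.
  by rewrite mulf_neq0 // -mcoeff_msupp; apply/inSupp_mon.
move=> y [w def_w [_ w_max]]; apply: NNPP => not_le; apply: b_not.
have sf : sigBelow s f.
  exists w => // t /w_max le_ty; apply/schreyer_srank.
  have lt_ys : (srank y < srank s)%N.
    rewrite ltnNge leq_eqVlt; apply/negP => /orP[/eqP/srank_inj eq_sy|lt_sy].
      by apply: not_le; left.
    by apply: not_le; right; apply/schreyer_srank.
  by case: le_ty => [<-//|/schreyer_srank lt_ty]; apply: ltn_trans lt_ys.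
have -> : b = c^-1 *: (f - (f - c *: b)).
  by rewrite opprB addrC subrK scalerA mulVf // scale1r.
by apply/sigBelowZ/(sigBelowB sf); exists v.
Qed.

Lemma evalAt_msupp_le u M :
    (forall t, inSupp u t -> (mrank (monImage t) <= mrank M)%N) ->
  forall m, m \in msupp (evalAt H u) -> (mrank m <= mrank M)%N.
Proof.
move=> ub m; rewrite mcoeff_msupp leqNgt; apply: contraNN => lt_m.
rewrite /evalAt raddf_sum big1 // => i _ /=; apply/eqP; rewrite mcoeff_eq0.
apply: contraL lt_m => m_in; rewrite -leqNgt.
apply: (msuppM_le_mrank ord_term ord_graded _ m_in) => x xu.
exact: (ub (x, i)).
Qed.

Lemma evalAt_mcoeff_top u M :
    (forall t, inSupp u t -> (mrank (monImage t) <= mrank M)%N) ->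
  (evalAt H u)@_M = \sum_(i < a) if (LM (tnth H i) <= M)%MM
    then (u 0 i)@_(M - LM (tnth H i)) * LC (tnth H i) else 0.
Proof.
move=> ub; rewrite /evalAt raddf_sum; apply: eq_bigr => i _ /=.
apply: mcoeffM_top => // x xu; exact: (ub (x, i)).
Qed.

(** In a syzygy of the leading monomials led by [s], the image of [s] must be cancelled by another
    term with the same image; maximality of [s] gives that term a smaller index. Conversely, [t]
    minus [s] is such a syzygy. *)
Lemma LSyL_spair s : LSyL ord H s <-> exists t, isSpair ord H (t, s).
Proof.
split=> [[u syz_u [su s_max]]|[t [/= lt_ts eq_ts]]].
  have : (evalAt (LMtuple ord H) u)@_(monImage s) = 0 by rewrite syz_u mcoeff0.
  rewrite raddf_sum (bigD1 s.2) //= tnth_mktuple {1}/Defs.monImage addmC mcoeffMX => sum0.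
  have [|] := boolP [exists i : 'I_a, (i != s.2) &&
      (monImage s \in msupp (u 0 i * 'X_[LM (tnth H i)]))].
    case/existsP => i /andP[ne_is]; rewrite (perm_mem (msuppMX _ _)) => /mapP[x xu def_s].
    have eq_xs : monImage (x, i) = monImage s by rewrite def_s /Defs.monImage addmC.
    exists (x, i); split=> //=.
    case: (s_max (x, i) xu) => [eq_s|[|[]//]]; first by rewrite eq_s eqxx in ne_is.
    by rewrite eq_xs (term_order_irr ord_term).
  rewrite negb_exists => /forallP no; move: su sum0; rewrite /inSupp mcoeff_msupp.
  rewrite [X in _ + X]big1 => [|i ne_i]; first by rewrite addr0 => /eqP.
  by have := no i; rewrite ne_i /= tnth_mktuple => /memN_msupp_eq0.
exists (mon t + (-1)%:MP *: mon s).
  rewrite /Syz evalAtD evalAt_Zmon evalAt_mon !tnth_mktuple -!mpolyXD.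
  by move: eq_ts; rewrite /Defs.monImage => ->; rewrite scaleN1r subrr.
split=> [|y /inSuppD[/inSupp_mon->|/inSuppZ/inSupp_mon->]]; [|by right; right|by left].
rewrite /inSupp !mxE mcoeff_msupp mcoeffD eqxx /=.
have -> : (s.2 == t.2) = false by apply/negP => /eqP eq_st; rewrite eq_st ltnn in lt_ts.
by rewrite eqxx mulr0 mcoeff0 add0r mulr1 mul_mpolyC mcoeffZ mcoeffX eqxx mulr1 oppr_eq0 oner_eq0.
Qed.

Context (H_neq0 : forall i, tnth H i != 0).

(** Induction on a bound for the support of [u]. If its top monomial [t] leads a syzygy of leading
    monomials, it also leads one of [H], and [t] can be removed without changing the value.
    Otherwise the image of [t] survives as the leading monomial of the value. *)
Lemma evalAt_LM_dvd N u :
    (forall t, (srank t < N)%N -> LSyL ord H t -> LSy ord H t) ->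
    (forall t, inSupp u t -> (srank t < N)%N) -> evalAt H u != 0 ->
  exists2 h, h \in H & (LM h <= LM (evalAt H u))%MM.
Proof.
elim: N u => [|N IHN] u syz_lt u_lt.
  case/eqP; rewrite /evalAt big1 // => i _.
  suff -> : u 0 i = 0 by rewrite mul0r.
  apply/eqP; apply: contraT => /(LM_msupp ord_term ord_graded) xu.
  by have := u_lt (_, i) xu.
have IH v := IHN v (fun t lt_tN => syz_lt t (ltnW lt_tN)).
have [[t [tu def_N]]|no_t] := classic (exists t, inSupp u t /\ srank t = N); last first.
  apply: IH => t tu; have := u_lt t tu; rewrite ltnS leq_eqVlt => /orP[/eqP eq_t|//].
  by case: no_t; exists t.
have lt_tN : (srank t < N.+1)%N by rewrite def_N.
have u_max y : inSupp u y -> y = t \/ schreyer y t.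
  move/u_lt; rewrite ltnS -def_N leq_eqVlt => /orP[/eqP/srank_inj|/schreyer_srank]; by [left|right].
have [t_syz|t_nsyz] := classic (LSyL ord H t).
  have [v v_syz [tv v_max]] := syz_lt t lt_tN t_syz.
  (* This multiple of the syzygy [v] cancels [t] and brings in only smaller monomials. *)
  set c := (u 0 t.2)@_t.1 / (v 0 t.2)@_t.1.
  have def_u : evalAt H (u - c%:MP *: v) = evalAt H u.
    by rewrite -scaleNr evalAtD evalAtZ v_syz mulr0 addr0.
  rewrite -def_u; apply: IH => y y_supp.
  have ne_yt : y <> t.
    move=> eq_yt; move: y_supp; rewrite eq_yt /inSupp 3!mxE mcoeff_msupp mcoeffB mul_mpolyC.
    by rewrite mcoeffZ divfK ?subrr ?eqxx // -mcoeff_msupp.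
  rewrite -def_N; apply/schreyer_srank.
  move: y_supp; rewrite -scaleNr -mpolyCN => /inSuppD[/u_max[]//|/inSuppZ/v_max[]//].
  by move=> eq_ty; case: ne_yt.
move=> _; set M := monImage t.
have ub y : inSupp u y -> (mrank (monImage y) <= mrank M)%N.
  by case/u_max => [->//|/schreyer_mrank_le].
have M_supp : M \in msupp (evalAt H u).
  rewrite mcoeff_msupp (evalAt_mcoeff_top ub) (bigD1 t.2) //= lem_addl addmK.
  rewrite big1 ?addr0 => [|i ne_it].
    by rewrite mulf_neq0 ?LC_neq0 // -mcoeff_msupp.
  (* A second contribution at [M] comes from a monomial [y] of [u] with the same image as [t]; being
     below [t], it would form an S-pair with [t]. *)
  case: ifP => // le_iM; have [->|nz] := eqVneq (u 0 i)@_(M - LM (tnth H i)) 0.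
    by rewrite mul0r.
  set y := ((M - LM (tnth H i))%MM, i); have eq_yM : monImage y = M by rewrite /Defs.monImage submK.
  have yu : inSupp u y by rewrite /inSupp mcoeff_msupp.
  case: t_nsyz; apply/LSyL_spair; exists y; split=> //=.
  case: (u_max y yu) => [eq_yt|[|[]//]]; first by rewrite -eq_yt eqxx in ne_it.
  by rewrite eq_yM (term_order_irr ord_term).
have -> : LM (evalAt H u) = M.
  by apply: LM_unique => // m; apply: evalAt_msupp_le.
by exists (tnth H t.2); rewrite ?mem_tnth // lem_addl.
Qed.

(** Both halves have leading monomial [M], and after division by the leading coefficients their
    coefficients there cancel. *)
Lemma Spoly_LM p : isSpair ord H p -> Spoly ord H p != 0 ->
  (mrank (LM (Spoly ord H p)) < mrank (monImage p.2))%N.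
Proof.
case=> lt_p eq_p nz; set M := monImage p.2; set c := fun t : modMon n a => (LC (tnth H t.2))^-1.
rewrite ltn_neqAle andbC; move: nz.
have -> : Spoly ord H p = evalAt H ((c p.1)%:MP *: mon p.1 + (- c p.2)%:MP *: mon p.2).
  by rewrite evalAtD !evalAt_Zmon scaleNr.
set u := _ + _ => nz.
have ub t : inSupp u t -> (mrank (monImage t) <= mrank M)%N.
  by case/inSuppD => /inSuppZ/inSupp_mon->; rewrite ?eq_p.
rewrite (evalAt_msupp_le ub) ?LM_msupp //=.
apply: contraTN (LM_msupp ord_term ord_graded nz) => /eqP/(mrank_inj ord_term ord_graded) ->.
have top t : monImage t = M -> ('X_[t.1] * tnth H t.2)@_M = LC (tnth H t.2).
  move=> def_M; rewrite (mcoeffM_top ord_term ord_graded) => [|x]; last first.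
    by rewrite msuppX inE => /eqP->; rewrite -def_M.
  by rewrite -def_M lem_addl addmK mcoeffX eqxx mul1r.
rewrite mcoeff_msupp negbK evalAtD !evalAt_Zmon mcoeffD !mcoeffZ.
by rewrite !top // mulNr !mulVf ?LC_neq0 // subrr.
Qed.

End Signatures.

(** * Ideal elements as evaluations, and truncation of polynomials *)

Lemma idealGen_evalAt (K : fieldType) (n a : nat) (T : a.-tuple {mpoly K[n]}) f :
  idealGen (fun h => h \in T) f <-> exists u, f = evalAt T u.
Proof.
split=> [[s sT ->]|[u ->]].
  elim: s sT => [|p s IHs] sT.
    exists 0; rewrite big_nil /evalAt big1 // => i _; by rewrite mxE mul0r.
  have [u def_u] : exists u, \sum_(q <- s) q.1 * q.2 = evalAt T u.
    by apply: IHs => q qs; apply: sT; rewrite inE qs orbT.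
  have /tnthP[i def_p] := sT p (mem_head _ _).
  exists (p.1 *: delta_mx 0 i + u).
  by rewrite evalAtD evalAtZ evalAt_delta big_cons def_u def_p.
rewrite /evalAt; elim/big_rec: _ => [|i g _ Ig]; first exact: idealGen0.
by apply: idealGenD => //; apply/idealGenM/idealGen_gen/mem_tnth.
Qed.

Section Restriction.
Context {K : fieldType} {n : nat}.

Definition mrestrict (P : pred 'X_{1..n}) (p : {mpoly K[n]}) : {mpoly K[n]} :=
  \sum_(x <- msupp p | P x) p@_x *: 'X_[x].

Lemma mcoeff_mrestrict P p y : (mrestrict P p)@_y = if P y then p@_y else 0.
Proof.
rewrite /mrestrict raddf_sum /=.
have [yp|/memN_msupp_eq0 p0] := boolP (y \in msupp p); last first.
  rewrite p0 if_same big1 // => x _; rewrite mcoeffZ mcoeffX.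
  by case: eqVneq => [->|_]; rewrite ?p0 ?mul0r ?mulr0.
rewrite big_mkcond (bigD1_seq y) ?msupp_uniq //= big1 => [|x /negbTE ne_xy].
  by rewrite addr0 mcoeffZ mcoeffX eqxx mulr1.
by rewrite mcoeffZ mcoeffX ne_xy mulr0 if_same.
Qed.

End Restriction.

(** * Enlarging [F] by elements of [G] *)

Section Extension.
Context {K : fieldType} {n : nat} (ord : rel 'X_{1..n}).
Context (ord_term : isTermOrder ord) (ord_graded : gradedOrder ord).
Context {m : nat} (F : m.-tuple {mpoly K[n]}) (s : modMon n m).
Implicit Types (T : seq {mpoly K[n]}) (f g h b r : {mpoly K[n]}).
Local Notation LM := (LM ord).
Local Notation LC := (LC ord).
Local Notation mrank := (mrank ord).
Local Notation M := (monImage ord F s).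
Local Notation a := ('X_[s.1] * tnth F s.2).

(** Each quotient is cut down to the terms whose product with the homogeneous generator has degree
    less than that of [M]. The discarded products live in degrees where [f] has no terms. *)
Lemma sigBelow_mdeg (F_homog : forall i, homogeneous (tnth F i)) f :
    (exists u, f = evalAt F u) -> (mdeg (LM f) < mdeg M)%N ->
  sigBelow ord F s f.
Proof.
move=> [u def_f] lt_fM; pose d i := mdeg (LM (tnth F i)).
have deg_supp i y : y \in msupp (tnth F i) -> mdeg y = d i.
  have [e /dhomogP Fe] := F_homog i => yF; rewrite [LHS](Fe _ yF) /d.
  by rewrite [RHS](Fe _ (LM_msupp ord_term ord_graded (msupp_neq0 yF))).
pose v : 'rV_m := \row_i mrestrict (fun x => mdeg x + d i < mdeg M)%N (u 0 i).
exists v => [[x i]|].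
  rewrite /inSupp mxE mcoeff_msupp mcoeff_mrestrict /=.
  case: ifP => [lt_xM _|]; last by rewrite eqxx.
  by left; apply: ord_graded; rewrite mdegD.
(* In low degree the discarded part contributes nothing; in high degree both sides vanish. *)
apply/mpolyP => y; have [lt_yM|le_My] := ltnP (mdeg y) (mdeg M).
  apply/eqP; rewrite -subr_eq0 -mcoeffB def_f /evalAt -sumrB raddf_sum big1 // => i _ /=.
  rewrite -mulrBl; apply/eqP; rewrite mcoeff_eq0; apply: contraL lt_yM.
  move/msuppM_le/allpairsP => [[x z] /= [xu /deg_supp z_deg ->]].
  rewrite mdegD z_deg -leqNgt leqNgt; apply: contraL xu => lt_xM.
  by rewrite mcoeff_msupp mcoeffB mxE mcoeff_mrestrict lt_xM subrr eqxx.
rewrite (msupp_coef0 ord_term ord_graded); last first.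
  by rewrite -(ord_mrank ord_term ord_graded); apply: ord_graded; apply: leq_trans le_My.
rewrite /evalAt raddf_sum big1 // => i _ /=.
apply/eqP; rewrite mcoeff_eq0; apply: contraL le_My.
move/msuppM_le/allpairsP => [[x z] /= [xu /deg_supp z_deg ->]].
move: xu; rewrite mxE mcoeff_msupp mcoeff_mrestrict mdegD z_deg -ltnNge.
by case: ifP; rewrite ?eqxx.
Qed.

(* The span of [T] and of the x^alpha f_i with x^alpha e_i below [s]. *)
Fixpoint sigSpan T f : Prop :=
  if T is h :: T' then exists c : K, sigSpan T' (f - c *: h) else sigBelow ord F s f.

Lemma sigSpanD T f g : sigSpan T f -> sigSpan T g -> sigSpan T (f + g).
Proof.
elim: T f g => [|h T IHT] f g /=; first exact: sigBelowD.
by move=> [c fc] [d gd]; exists (c + d); rewrite scalerDl opprD addrACA; apply: IHT.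
Qed.

Lemma sigSpanZ T (c : K) f : sigSpan T f -> sigSpan T (c *: f).
Proof.
elim: T f => [|h T IHT] f /=; first exact: sigBelowZ.
by move=> [d fd]; exists (c * d); rewrite -scalerA -scalerBr; apply: IHT.
Qed.

Lemma sigSpanB T f g : sigSpan T f -> sigSpan T g -> sigSpan T (f - g).
Proof. by move=> Tf Tg; apply: sigSpanD => //; rewrite -scaleN1r; apply: sigSpanZ. Qed.

Lemma sigSpan_sig T f : sigBelow ord F s f -> sigSpan T f.
Proof. by move=> sf; elim: T => //= h T IHT; exists 0; rewrite scale0r subr0. Qed.

Lemma sigSpan_mem T h : h \in T -> sigSpan T h.
Proof.
elim: T => //= g T IHT; rewrite inE => /orP[/eqP->|/IHT Th].
  by exists 1; rewrite scale1r subrr; apply/sigSpan_sig/sigBelow0.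
by exists 0; rewrite scale0r subr0.
Qed.

Lemma sigSpan_ind T (P : {mpoly K[n]} -> Prop) :
    (forall f, sigBelow ord F s f -> P f) -> (forall h, h \in T -> P h) ->
    (forall f g, P f -> P g -> P (f + g)) -> (forall (c : K) f, P f -> P (c *: f)) ->
  forall f, sigSpan T f -> P f.
Proof.
move=> P_sig P_mem PD PZ; elim: T P_mem => [|h T IHT] //= P_mem f [c Tfc].
rewrite -(subrK (c *: h) f); apply: PD.
  by apply: IHT Tfc => g gT; apply: P_mem; rewrite inE gT orbT.
by apply/PZ/P_mem; rewrite mem_head.
Qed.

Context (F_neq0 : forall i, tnth F i != 0).
Context (F_homog : forall i, homogeneous (tnth F i)).
Context (G : seq {mpoly K[n]}).
Local Notation I := (idealGen (fun h => h \in F)).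
Context (G_neq0 : forall h, h \in G -> h != 0).
Context (G_ideal : forall h, h \in G -> I h).
Context (G_dvd : forall f, I f -> f != 0 -> exists2 h, h \in G & (LM h <= LM f)%MM).

Definition reducible T f : Prop := exists2 h, h \in F ++ T & (LM h <= LM f)%MM.

(** The loop invariant. Membership in [T] fixes the degree, so that only scalar multiples of
    elements of [T] can lie below [s]; the last clause keeps 0 out of the cosets of nonzero
    multiples of [a]. *)
Definition goodExtension T : Prop :=
  [/\ uniq T, {subset T <= G},
      forall h, h \in T -> [/\ h \notin F, mdeg (LM h) = mdeg M & ord (LM h) M],
      forall f, sigSpan T f -> f != 0 -> reducible T f
    & ~ sigSpan T a].

(** The element [b], in use the S-polynomial, serves to force the minimal leading monomial of the
    coset strictly below [M]. *)
Lemma exists_irreducible T b c : goodExtension T ->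
    c != 0 -> sigBelow ord F s (b - c *: a) -> (b != 0%R -> mrank (LM b) < mrank M)%N ->
  exists g, [/\ g \in G, ~ reducible T g, mdeg (LM g) = mdeg M & ord (LM g) M].
Proof.
move=> [T_uniq T_sub T_deg T_red aT] c0 b_sig b_lt.
pose coset f := exists2 d : K, d != 0 & sigSpan T (f - d *: a).
have coset_neq0 f : coset f -> f != 0.
  case=> d d0 Tfd; apply/eqP => f0; apply: aT.
  have -> : a = (- d)^-1 *: (f - d *: a).
    by rewrite f0 sub0r -scaleNr scalerA mulVf ?oppr_eq0 // scale1r.
  exact: sigSpanZ.
have coset_b : coset b by exists c => //; apply: sigSpan_sig.
have [r coset_r r_min] := exists_minimal (fun f => mrank (LM f)) (ex_intro _ b coset_b).
have r0 := coset_neq0 r coset_r.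
have lt_rM : (mrank (LM r) < mrank M)%N.
  exact: leq_ltn_trans (r_min b coset_b) (b_lt (coset_neq0 b coset_b)).
have le_rM := leq_mrank_mdeg ord_term ord_graded (ltnW lt_rM).
(* A reducer [h] gives an element [q] of the span with the leading monomial of [r]: for [h] in [F]
   it lies below [s], and for [h] in [T] the degrees force [x] to be 0. Subtracting a multiple of
   [q] contradicts minimality. *)
have r_irr : ~ reducible T r.
  case=> h hFT le_hr; set x := (LM r - LM h)%MM.
  have h0 : h != 0.
    move: hFT; rewrite mem_cat => /orP[/tnthP[i ->]|/T_sub/G_neq0] //.
  set q := 'X_[x] * h; have q0 : q != 0 by rewrite mulf_neq0 // -msupp_eq0 msuppX.
  have LMq : LM q = LM r.
    rewrite LMM //; first by rewrite LMX // submK.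
    by rewrite -msupp_eq0 msuppX.
  have Tq : sigSpan T q.
    move: hFT; rewrite mem_cat => /orP[/tnthP[i def_h]|hT].
      rewrite /q def_h; apply: sigSpan_sig; apply: (sigBelow_mon (t := (x, i))); left.
      by rewrite /monImage -def_h submK // (ord_mrank ord_term ord_graded).
    have [_ deg_h _] := T_deg h hT; suff /eqP x0 : x == 0%MM.
      by rewrite /q x0 mpolyX0 mul1r; apply: sigSpan_mem.
    rewrite -mdeg_eq0 -leqn0 -(leq_add2r (mdeg (LM h))) add0n -mdegD submK //.
    by rewrite deg_h.
  set e := LC r / LC q; have [d d0 Trd] := coset_r.
  have coset_r' : coset (r - e *: q).
    exists d => //; rewrite addrAC; apply: sigSpanB => //; exact: sigSpanZ.
  have := r_min _ coset_r'; rewrite leqNgt => /negP; apply.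
  exact: LM_cancel (coset_neq0 _ coset_r').
have Ir : I r.
  have [d d0 Trd] := coset_r; rewrite -(subrK (d *: a) r); apply: idealGenD; last first.
    by rewrite -mul_mpolyC; do 2!apply: idealGenM; apply/idealGen_gen/mem_tnth.
  move: Trd; apply: sigSpan_ind => [f [u _ ->]|h /T_sub/G_ideal//|f g|e f If].
  - by apply/idealGen_evalAt; exists u.
  - exact: idealGenD.
  - by rewrite -mul_mpolyC; apply: idealGenM.
have [g gG le_gr] := G_dvd Ir r0.
have g_irr : ~ reducible T g.
  by case=> h hFT le_hg; apply: r_irr; exists h => //; apply: lepm_trans le_gr.
(* In smaller degree [g] would lie in the span, hence be reducible by the invariant. Divisibility
   and equal degree then identify the two leading monomials. *)
have le_Mg : (mdeg M <= mdeg (LM g))%N.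
  rewrite leqNgt; apply/negP => lt_gM; apply: g_irr; apply: T_red (G_neq0 gG).
  by apply/sigSpan_sig/sigBelow_mdeg => //; apply/idealGen_evalAt/G_ideal.
have eq_gr : LM g = LM r.
  rewrite -(submK le_gr); suff /eqP-> : (LM r - LM g)%MM == 0%MM by rewrite add0m.
  rewrite -mdeg_eq0 -leqn0 -(leq_add2r (mdeg (LM g))) add0n -mdegD submK //.
  exact: leq_trans le_Mg.
exists g; split=> //; last by rewrite eq_gr (ord_mrank ord_term ord_graded).
by apply/eqP; rewrite eqn_leq le_Mg eq_gr le_rM.
Qed.

(** For [f = w + c *: g], the leading monomials of [w] and [g] cannot agree, since [w] is reducible
    and [g] is not. So the larger one leads [f], and it is reducible once [g] is available. *)
Lemma goodExtension_cons T g : goodExtension T -> g \in G -> ~ reducible T g ->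
    mdeg (LM g) = mdeg M -> ord (LM g) M -> ~ sigSpan (g :: T) a ->
  goodExtension (g :: T).
Proof.
move=> [T_uniq T_sub T_deg T_red aT] gG g_irr deg_g lt_gM a_not; split=> //.
- rewrite /= T_uniq andbT; apply/negP => gT; apply: g_irr.
  by exists g; rewrite ?lepm_refl // mem_cat gT orbT.
- by move=> h; rewrite inE => /orP[/eqP->|/T_sub].
- move=> h; rewrite inE => /orP[/eqP->|/T_deg//]; split=> //.
  by apply/negP => gF; apply: g_irr; exists g; rewrite ?lepm_refl // mem_cat gF.
have sub h : h \in F ++ T -> h \in F ++ g :: T.
  by rewrite !mem_cat inE => /orP[->//|->]; rewrite !orbT.
have g_red f : LM f = LM g -> reducible (g :: T) f.
  by move=> eq_fg; exists g; rewrite ?eq_fg ?lepm_refl // mem_cat mem_head orbT.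
move=> f [c]; set w := f - c *: g => Tw f0; have def_f : f = w + c *: g by rewrite subrK.
have [c0|c0] := eqVneq c 0.
  have eq_fw : f = w by rewrite def_f c0 scale0r addr0.
  by rewrite -eq_fw in Tw; have [h /sub] := T_red f Tw f0; exists h.
have cg0 : c *: g != 0 by rewrite scaler_eq0 negb_or c0 G_neq0.
have [w0|w0] := eqVneq w 0; first by apply: g_red; rewrite def_f w0 add0r LMZ.
have [h hFT le_hw] := T_red w Tw w0.
have addl := LM_addl ord_term ord_graded.
have [lt_wg|lt_gw|/(mrank_inj ord_term ord_graded) eq_wg] :=
  ltngtP (mrank (LM w)) (mrank (LM g)).
- apply: g_red; rewrite def_f; have [|_ ->] := addl _ w _ cg0; last exact: LMZ.
  by right; rewrite LMZ.
- exists h; first exact: sub.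
  rewrite def_f addrC; have [|_ ->//] := addl _ (c *: g) _ w0.
  by right; rewrite LMZ.
- by case: g_irr; exists h; rewrite // -eq_wg.
Qed.

(** The process ends because [T] stays a duplicate-free part of the finite [G]. It stops when [g]
    brings [a] into the span; the coefficient of [g] is then nonzero, so [g] is a multiple of [a]
    modulo the old span. *)
Lemma exists_goodExtension T b c : goodExtension T ->
    c != 0 -> sigBelow ord F s (b - c *: a) -> (b != 0%R -> mrank (LM b) < mrank M)%N ->
  exists T' g, [/\ goodExtension T', g \in G, ~ reducible T' g
    & exists2 d : K, d != 0 & sigSpan T' (g - d *: a)].
Proof.
have [N] := ubnP (size G - size T)%N; elim: N T => // N IHN T /ltnSE leN T_good c0 b_sig b_lt.
have [g [gG g_irr deg_g lt_gM]] := exists_irreducible T_good c0 b_sig b_lt.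
have [[d Tad]|a_not] := classic (sigSpan (g :: T) a).
  have [_ _ _ _ aT] := T_good; have d0 : d != 0.
    by apply: contra_notN aT => /eqP d0; rewrite d0 scale0r subr0 in Tad.
  exists T, g; split=> //; exists d^-1; rewrite ?invr_eq0 //.
  rewrite -[X in X - _]scale1r -(mulVf d0) -scalerA -scalerBr -opprB scalerN -scaleNr.
  exact: sigSpanZ.
have gT_good := goodExtension_cons T_good gG g_irr deg_g lt_gM a_not.
apply: (IHN (g :: T)) => //; have [gT_uniq gT_sub _ _ _] := gT_good.
(* Needed because the subtraction in the measure is truncated. *)
have lt_TG : (size T < size G)%N := uniq_leq_size gT_uniq gT_sub.
by apply: leq_trans leN; apply: ltn_sub2l.
Qed.

(** This turns the linear span into a statement on signatures for the extended tuple, which is where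
    the degree and order clauses of the invariant are used. *)
Lemma sigBelow_cat T : goodExtension T ->
  forall f, sigBelow ord (cat_tuple F (in_tuple T)) (widenMon (size T) s) f <-> sigSpan T f.
Proof.
move=> [_ _ T_deg _ _]; set F' := cat_tuple F _; set E := in_tuple T.
have tnthl i : tnth F' (lshift _ i) = tnth F i by rewrite tnth_lshift.
have tnthr i : tnth F' (rshift _ i) = tnth E i by rewrite tnth_rshift.
have evalF' u v : evalAt F' (row_mx u v) = evalAt F u + evalAt E v.
  rewrite /evalAt big_split_ord /=.
  by congr (_ + _); apply: eq_bigr => i _; rewrite ?row_mxEl ?row_mxEr ?tnthl ?tnthr.
have monM : monImage ord F' (widenMon (size T) s) = M by rewrite /monImage tnthl.
move=> f; split=> [[u us ->]|].
  rewrite -(hsubmxK u) evalF'; apply: sigSpanD.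
    apply: sigSpan_sig; exists (lsubmx u) => // -[x i].
    rewrite /inSupp mxE => /(us (x, lshift _ i)).
    by rewrite /schreyer monM /monImage tnthl.
  rewrite /evalAt; elim/big_rec: _ => [|i g _ Tg]; first exact/sigSpan_sig/sigBelow0.
  apply: sigSpanD Tg; have ET : tnth E i \in T by apply: mem_tnth.
  have [_ deg_i _] := T_deg _ ET.
  (* A monomial below [s] has image of degree at most that of [M], already reached by the element of
     [T], so its quotient is constant. *)
  suff -> : rsubmx u 0 i = ((rsubmx u 0 i)@_0)%:MP.
    by rewrite mul_mpolyC; apply/sigSpanZ/sigSpan_mem.
  apply/mpolyP => x; rewrite mcoeffC; have [->|x0] := eqVneq 0%MM x; first by rewrite mulr1.
  rewrite mulr0; apply/eqP; rewrite mcoeff_eq0; apply: contraNN x0; rewrite mxE.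
  move=> /(us (x, rshift _ i))/(schreyer_mrank_le ord_term ord_graded).
  rewrite monM /monImage tnthr => /(leq_mrank_mdeg ord_term ord_graded) /=.
  by rewrite mdegD deg_i -{2}[mdeg M]add0n leq_add2r leqn0 mdeg_eq0 eq_sym.
apply: sigSpan_ind => [_ [u us ->]|h hT|g h|c g].
- exists (row_mx u 0).
    move=> [x i]; rewrite /inSupp /= mxE; case: split_ordP => j ->; last first.
      by rewrite mxE msupp0.
    by move=> /(us (x, j)); rewrite /schreyer monM /monImage tnthl.
  rewrite evalF' [X in _ + X](_ : _ = 0) ?addr0 //.
  by rewrite /evalAt big1 // => i _; rewrite mxE mul0r.
- have /tnthP[i def_h] : h \in E by [].
  have [_ _ lt_hM] := T_deg h hT.
  have -> : h = 'X_[0%MM] * tnth F' (rshift _ i) by rewrite mpolyX0 mul1r tnthr.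
  (* The new indices exceed that of [s], so only a strictly smaller image puts them below [s]. *)
  apply: (sigBelow_mon (t := (0%MM, rshift _ i))); left.
  by rewrite monM /monImage tnthr -def_h add0m.
- exact: sigBelowD.
- exact: sigBelowZ.
Qed.

End Extension.

(** * The minimal guessed signature and the conclusion *)

Lemma exists_LSyL_not_LSy (K : fieldType) (n : nat) (ord : rel 'X_{1..n})
    (m : nat) (F : m.-tuple {mpoly K[n]}) (I : {mpoly K[n]} -> Prop)
    (ord_term : isTermOrder ord) (ord_graded : gradedOrder ord)
    (F_neq0 : forall i, tnth F i != 0)
    (I_def : forall f, I f <-> idealGen (fun h => h \in F) f) :
  ~ groebnerBasis ord I F -> exists s, LSyL ord F s /\ ~ LSy ord F s.
Proof.
move=> F_not; apply: NNPP => no_s; apply: F_not; split=> //.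
  by apply/negP => /tnthP[i F0]; have := F_neq0 i; rewrite -F0 eqxx.
move=> f; split; apply: idealGen_sub => ? [g].
  move=> [Ig g0 ->]; apply/LMideal_monomial => //.
  have /I_def/idealGen_evalAt[u def_g] := Ig; rewrite def_g in g0 *.
  (* Any bound above all ranks in the support will do; the sum of their successors is one. *)
  pose N := (\sum_(i < m) \sum_(x <- msupp (u ord0 i)) (srank ord F (x, i)).+1)%N.
  apply: (evalAt_LM_dvd (N := N) ord_term ord_graded F_neq0) => // [t _ t_syz|[x i] xu].
    by apply: NNPP => t_not; apply: no_s; exists t.
  rewrite /N (bigD1 i) //= (big_rem x) //=; exact: leq_trans (leq_addr _ _) (leq_addr _ _).
move=> gF ->; apply: idealGen_gen; exists g; split=> //; first exact/I_def/idealGen_gen.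
by have /tnthP[i ->] := gF.
Qed.

Theorem corollary4p4 (K : fieldType) (n : nat) (ord : rel 'X_{1..n})
    (m : nat) (F : m.-tuple {mpoly K[n]}) (I : {mpoly K[n]} -> Prop)
    (G : seq {mpoly K[n]})
    (ord_term : isTermOrder ord)
    (F_neq0 : forall i, tnth F i != 0)
    (I_def : forall f, I f <-> idealGen (fun h => h \in F) f)
    (F_not_groebner : ~ groebnerBasis ord I F)
    (F_homog : forall i, homogeneous (tnth F i))
    (ord_graded : gradedOrder ord)
    (G_groebner : groebnerBasis ord I G)
    (G_homog : forall h, h \in G -> homogeneous h)
    (F_sub_G : {subset F <= G}) :
  exists (k : nat) (E : k.-tuple {mpoly K[n]}) (g : {mpoly K[n]})
         (p : modMon n m * modMon n m),
    let F' := cat_tuple F E in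
    [/\ [/\ {subset E <= G}, uniq E & forall h, h \in E -> h \notin F],
        (g \in G /\ g \notin F') /\ isSpair ord F p,
        isMinimum (schreyer ord F)
          (fun s => LSyL ord F s /\ ~ LSy ord F s) (guessedSig p),
        isSignature ord F' g (widenMon k (guessedSig p)) /\
        (forall q r, isDivision ord F' (Spoly ord F p) q r ->
           [/\ r != 0, LM ord g = LM ord r &
               isSignature ord F' r (widenMon k (guessedSig p))]) &
        simplified ord G ->
        forall q r, isDivision ord F' (Spoly ord F p) q r ->
          exists c : K, g = c *: r].
Proof.
have [G0 I_G G_lead] := G_groebner.
have G_neq0 h : h \in G -> h != 0 by move=> hG; apply: contraNneq G0 => <-.
have G_ideal h : h \in G -> idealGen (fun h => h \in F) h.
  by move=> hG; apply/I_def/I_G/idealGen_gen.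
have G_dvd f : idealGen (fun h => h \in F) f -> f != 0 ->
    exists2 h, h \in G & (LM ord h <= LM ord f)%MM.
  move=> /I_def If f0; apply/LMideal_monomial/G_lead.
  by apply: idealGen_gen; exists f.
have [s [s_syzL s_nsyz] s_min] := exists_minimal (srank ord F)
  (exists_LSyL_not_LSy ord_term ord_graded F_neq0 I_def F_not_groebner).
have [t ts_pair] := (LSyL_spair ord_term F s).1 s_syzL.
set M := monImage ord F s; set a := 'X_[s.1] * tnth F s.2.
(* Minimality of [s] gives reducibility below [s]. If [a] were the value of some [u] below [s], then
   [mon s] minus [u] would be a syzygy led by [s]. *)
have nil_good : goodExtension ord F s G [::].
  split=> // [f [u us ->] f0|[u us def_a]].
    rewrite /reducible cats0.
    apply: (evalAt_LM_dvd (N := srank ord F s) ord_term ord_graded F_neq0) => //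
      [y lt_ys y_syz|y /us].
      by apply: NNPP => y_not; have := s_min y (conj y_syz y_not); rewrite leqNgt lt_ys.
    by move/(schreyer_srank ord_term ord_graded).
  apply: s_nsyz; exists (mon s + (-1)%:MP *: u).
    by rewrite /Syz evalAtD evalAtZ evalAt_mon def_a mul_mpolyC scaleN1r subrr.
  split=> [|y /inSuppD[/inSupp_mon->|/inSuppZ/us]]; [|by left|by right].
  have us0 : (u 0 s.2)@_s.1 = 0.
    apply/eqP; rewrite mcoeff_eq0; apply/negP => /us/(schreyer_srank ord_term ord_graded).
    by rewrite ltnn.
  rewrite /inSupp mcoeff_msupp mxE mcoeffD [X in _ + X](_ : _ = 0).
    by rewrite addr0 -mcoeff_msupp; apply/inSupp_mon.
  by rewrite mxE mul_mpolyC mcoeffZ us0 mulr0.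
set p := (t, s); set b := Spoly ord F p.
(* The coefficient of [a] in the S-polynomial; the other half belongs to [t], which is below [s]. *)
set c0 := - (LC ord (tnth F s.2))^-1.
have c0_neq0 : c0 != 0 by rewrite oppr_eq0 invr_eq0 LC_neq0.
have lt_ts : schreyer ord F t s by have [lt_i eq_m] := ts_pair; right.
have b_sig : sigBelow ord F s (b - c0 *: a).
  rewrite /b /Spoly -/a scaleNr opprK subrK; apply/sigBelowZ; exact: sigBelow_mon.
have b_lt : b != 0 -> (mrank ord (LM ord b) < mrank ord M)%N by apply: Spoly_LM.
have [E [g [E_good gG g_irr [d d0 g_coset]]]] := exists_goodExtension
  ord_term ord_graded F_neq0 F_homog G_neq0 G_ideal G_dvd nil_good c0_neq0 b_sig b_lt.
have [E_uniq E_sub E_deg E_red a_not] := E_good.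
exists (size E), (in_tuple E), g, p; move=> F'.
have sigF' := sigBelow_cat ord_term ord_graded E_good.
have F's : 'X_[(widenMon (size E) s).1] * tnth F' (widenMon (size E) s).2 = a.
  by rewrite /= tnth_lshift.
have sign f c : c != 0 -> sigSpan ord F s E (f - c *: a) ->
    isSignature ord F' f (widenMon (size E) s).
  move=> c_neq0 Ef; apply: (isSignature_coset ord_term ord_graded c_neq0); rewrite F's.
    exact/sigF'.
  by move/sigF'.
have irr_supp f : ~ reducible ord F E f -> ~ LMideal ord F' 'X_[LM ord f].
  by move=> f_irr /LMideal_monomial.
have division q r : isDivision ord F' b q r -> exists2 c, c != 0 &
    sigSpan ord F s E (g - c *: r) /\ (r != 0 /\ isSignature ord F' r (widenMon (size E) s)).
  move=> [def_b q_le r_irr].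
  (* The products in the division do not exceed the leading monomial of [b], which is below [M]; so
     the quotient part has signature below [s]. *)
  have Eq : sigSpan ord F s E (b - r).
    apply/sigF'; rewrite def_b addrK; exists q => // -[x i] xq.
    have qi0 : q 0 i != 0 := msupp_neq0 xq.
    have [b0 le_qb] := q_le i qi0.
    have F'0 : tnth F' i != 0.
      have : tnth F' i \in F ++ E by apply: mem_tnth.
      by rewrite mem_cat => /orP[/tnthP[j ->]//|/E_sub/G_neq0].
    set l := LM ord (q 0 i * tnth F' i) in le_qb.
    have le_xl : (mrank ord (x + LM ord (tnth F' i)) <= mrank ord l)%N.
      by rewrite /l LMM // leq_mrankD // msupp_le_LM.
    have le_lb : (mrank ord l <= mrank ord (LM ord b))%N.
      by case: le_qb => [->//|]; rewrite (ord_mrank ord_term ord_graded) => /ltnW.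
    left; rewrite (ord_mrank ord_term ord_graded) /monImage /= tnth_lshift.
    exact: leq_ltn_trans (leq_trans le_xl le_lb) (b_lt b0).
  have Er : sigSpan ord F s E (r - c0 *: a).
    rewrite -(subrK b r) -addrA; apply: sigSpanD; last exact: sigSpan_sig.
    by rewrite -opprB -scaleN1r; apply: sigSpanZ.
  exists (d / c0); first by rewrite mulf_neq0 ?invr_eq0.
  have -> : g - (d / c0) *: r = (g - d *: a) - (d / c0) *: (r - c0 *: a).
    by rewrite scalerBr scalerA divfK // opprB addrA subrK.
  split; first by apply: sigSpanB => //; apply: sigSpanZ.
  split; last exact: sign Er.
  apply/eqP => r0; apply: a_not; rewrite -/a.
  have -> : a = (- c0)^-1 *: (r - c0 *: a).
    by rewrite r0 sub0r -scaleNr scalerA mulVf ?scale1r // oppr_eq0.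
  exact: sigSpanZ.
have diff_red f : sigSpan ord F s E f -> f != 0 -> LMideal ord F' 'X_[LM ord f].
  by move=> Ef f0; apply/LMideal_monomial/E_red.
split.
- by split=> // h /E_deg[].
- split=> //; split=> //; apply/negP => gF'; apply: g_irr.
  by exists g; rewrite ?lepm_refl.
- split=> // y /s_min; rewrite leq_eqVlt => /orP[/eqP/(srank_inj ord_term ord_graded)|].
    by left.
  by right; apply/(schreyer_srank ord_term ord_graded).
- split=> [|q r div_r]; first exact: sign g_coset.
  have [c c_neq0 [Egr [r0 r_sign]]] := division q r div_r; split=> //.
  have [_ _ r_irr] := div_r.
  have g0 := G_neq0 g gG.
  have cr0 : - c *: r != 0 by rewrite scaler_eq0 oppr_eq0 negb_or c_neq0.
  have LMcr : LM ord (- c *: r) = LM ord r by rewrite LMZ // oppr_eq0.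
  rewrite -scaleNr in Egr.
  have addl := LM_addl ord_term ord_graded.
  (* If the leading monomials differed, the larger one would lead [g - c *: r], hence be reducible,
     against the irreducibility of [g] or of the terms of [r]. *)
  have [lt_gr|lt_rg|/(mrank_inj ord_term ord_graded)//] :=
    ltngtP (mrank ord (LM ord g)) (mrank ord (LM ord r)).
  + have [|s0 eq_s] := addl _ g _ cr0; first by right; rewrite LMcr.
    have := diff_red _ Egr s0; rewrite eq_s LMcr => /r_irr[].
    exact: LM_msupp.
  + have [|s0 eq_s] := addl _ (- c *: r) _ g0; first by right; rewrite LMcr.
    rewrite addrC in s0 eq_s.
    by have := diff_red _ Egr s0; rewrite eq_s => /irr_supp.
(* A nonzero difference has a reducible leading monomial, occurring in [g] or [r]. It is no term of
   the remainder, not the leading monomial of [g], and no other term of [g] because [G] is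
   simplified and contains [F']. *)
- move=> G_simpl q r div_r; have [c c_neq0 [Egr _]] := division q r div_r.
  have [_ _ r_irr] := div_r; exists c; apply/eqP; rewrite -subr_eq0.
  apply: contraT => diff0; have := diff_red _ Egr diff0.
  have := LM_msupp ord_term ord_graded diff0; set x := LM ord _.
  move/msuppD_le; rewrite mem_cat (perm_mem (msuppN _)) => /orP[xg|/msuppZ_le/r_irr//].
  have [->|x_neq] := eqVneq x (LM ord g); first by move/irr_supp.
  have := G_simpl g x gG xg x_neq => x_not.
  move=> /LMideal_monomial[h hF' le_hx]; case: x_not.
  apply/LMideal_monomial; exists h => //.
  by move: hF'; rewrite mem_cat => /orP[/F_sub_G|/E_sub].
Qed.
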